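(* For every real $r$ with $-\frac{8}{15}<r<\frac{2}{15}$, we have $$-2i\,(\mathcal{K}\cap\Delta_{0,1,r/2})=(\mathcal{K}\cap\Delta_{1,0,r})+\{0,i\},$$ $$(-1+i)\,(\mathcal{K}\cap\Delta_{1,1,-r})=\mathcal{K}\cap\Delta_{1,0,r},$$ $$(-1+i)\,(\mathcal{K}\cap\Delta_{1,-1,r/2})=(\mathcal{K}\cap\Delta_{0,1,r/2})+\{0,1\},$$ $$2(1+i)\,(\mathcal{K}\cap\Delta_{1,-1,r/2})=(\mathcal{K}\cap\Delta_{1,0,r})+\{-2i,-i,0,i\}.$$ In particular, if $r=\sum_{k=1}^\infty\frac{2a_k}{(-4)^k}$ for some sequence $a_1a_2\cdots\in\{0,1\}^\omega$ not ending in $(01)^\omega$, then the sets $\mathcal{K}\cap\Delta_{0,1,r/2}$, $\mathcal{K}\cap\Delta_{1,1,-r}$ and $\mathcal{K}\cap\Delta_{1,-1,r/2}$ are closed line segments with endpoints $$\partial\mathcal{K}\cap\Delta_{0,1,r/2}=\partial(\mathcal{K}\cap\Delta_{0,1,r/2})=\left\{-\tfrac45-\tfrac r2+\tfrac r2\,i,\ \tfrac15-\tfrac r2+\tfrac r2\,i\right\},$$ $$\partial\mathcal{K}\cap\Delta_{1,1,-r}=\partial(\mathcal{K}\cap\Delta_{1,1,-r})=\left\{-\tfrac15+\left(\tfrac15-r\right)i,\ \tfrac3{10}-\left(\tfrac3{10}+r\right)i\right\},$$ $$\partial\mathcal{K}\cap\Delta_{1,-1,r/2}=\partial(\mathcal{K}\cap\Delta_{1,-1,r/2})=\left\{-\tfrac35+\tfrac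 r2-\tfrac35\,i,\ \tfrac25+\tfrac r2+\tfrac25\,i\right\}.$$
   Context: Let $\alpha=-1+i$. The Knuth Twin Dragon is the compact set $\mathcal{K}=\left\{\sum_{k=1}^\infty d_k\alpha^{-k} : d_k\in\{0,1\}\right\}\subset\mathbb{C}$, and $\partial\mathcal{K}$ is its topological boundary in $\mathbb{C}$. For real $p,q,r$, $\Delta_{p,q,r}=\{x+iy\in\mathbb{C} : x,y\in\mathbb{R},\ px+qy=r\}$. For a line $\Delta$, $\partial(\mathcal{K}\cap\Delta)$ denotes the boundary of $\mathcal{K}\cap\Delta$ relative to the line $\Delta$ (the set of the two endpoints when $\mathcal{K}\cap\Delta$ is a closed segment). For $c\in\mathbb{C}$ and $X,Y\subset\mathbb{C}$, $cX=\{cx : x\in X\}$ and $X+Y=\{x+y : x\in X,\ y\in Y\}$. A sequence ends in $(01)^\omega$ if some tail of it equals the periodic sequence $010101\cdots$. *)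

(* Defs.v *)
From Stdlib Require Export Reals Ensembles.
From Coquelicot Require Export Coquelicot.

Open Scope R_scope.

Definition alpha : C := (-1 + Ci)%C.

(** Sequences of binary digits are indexed from [0]: the term [d k] is the
    digit of index [k + 1] of the mathematical sequence. *)
Definition digit (b : bool) : R := INR (Nat.b2n b).

Definition twin_dragon : Ensemble C := fun z =>
  exists d : nat -> bool,
    is_series (V := C_NormedModule)
      (fun k => (RtoC (digit (d k)) / alpha ^ S k)%C) z.

Definition line (p q r : R) : Ensemble C := fun z => p * Re z + q * Im z = r.

Definition dilate (c : C) (X : Ensemble C) : Ensemble C := fun z =>
  exists x, X x /\ z = (c * x)%C.

Definition sumset (X Y : Ensemble C) : Ensemble C := fun z =>
  exists x y, X x /\ Y y /\ z = (x + y)%C.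

Definition closed_segment (u v : C) : Ensemble C := fun z =>
  exists t : R, 0 <= t <= 1 /\ z = (RtoC (1 - t) * u + RtoC t * v)%C.

Definition boundary (A : Ensemble C) : Ensemble C := fun z =>
  forall P : C -> Prop, locally z P ->
    (exists w, P w /\ A w) /\ (exists w, P w /\ ~ A w).

(** Boundary of [A], a subset of [D], for the subspace topology of [D]. *)
Definition boundary_in (D A : Ensemble C) : Ensemble C := fun z =>
  D z /\
  forall P : C -> Prop, locally z P ->
    (exists w, D w /\ P w /\ A w) /\ (exists w, D w /\ P w /\ ~ A w).

(** Some tail of the sequence is [0, 1, 0, 1, ...]. *)
Definition ends_in_01 (a : nat -> bool) : Prop :=
  exists n, forall k, a (n + k)%nat = Nat.odd k.

Arguments Intersection {U} B C _.
Arguments Union {U} B C _.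

Declare Scope cset_scope.
Delimit Scope cset_scope with cset.
Notation "A ∩ B" := (Intersection A B) (at level 40, left associativity) : cset_scope.
Notation "{{ u , v }}" := (Couple C u%C v%C) (at level 0, u at level 99, v at level 99) : cset_scope.
Notation "A == B" := (Same_set C A B) (at level 70, no associativity) : cset_scope.
Open Scope cset_scope.

(* Main.v *)
Require Import Defs.
From Stdlib Require Import Lra Lia ZArith List Classical ClassicalEpsilon.

(** The map [step b : z |-> alpha z - b] drops the first digit of an expansion,
    so the twin dragon [K] is the largest bounded set in which every point
    has a [step] into the set ([twin_dragon_coind]). It lies in an octagon
    ([twin_dragon_octagon]), and its Gaussian translates cover the plane
    ([twin_dragon_tiles]).

    The four equalities compare one slice with another by steps. One step
    carries the line [x - y = r/2] to [y = r/2], two steps carry [y = r/2] and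
    one step carries [x + y = -r] to one of the lines [x = r - 1], [x = r],
    [x = r + 1], depending on the digits. For [-8/15 < r < 2/15] the lines
    [x = r - 1] and [x = r + 1] miss the octagon, so the digits must lead to
    [x = r]; those that remain free are the summands [0] and [i], [0] and [1],
    and so on.

    Four steps have [alpha^4 = -4] and act on real and imaginary parts by
    [x |-> -4 x - (2 d1 - d3 + d4)] and [y |-> -4 y - (2 d1 - 2 d2 + d3)]. If
    [r] has digits [2 a_k] in base [-4] and the tails of [r] stay strictly
    between [-8/15] and [2/15], which is what the condition on [(01)^omega]
    guarantees ([cantor_real_bounds]), then a point of [K] on [x = r] can only
    use the digits with [2 d1 - d3 + d4 = 2 a_k], that is [d1 = a_k] and
    [d3 = d4]: any other choice would put the real part at distance at least 1
    from the tail of [r], outside the octagon. The digits [d2] and [d3] remain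
    free, and [-2 d2 + d3] runs over the four consecutive values
    [-2, -1, 0, 1]: a full digit set in base [-4], which fills an interval of
    length 1. Hence [K] meets [x = r] exactly in
    [r - 2/5 <= y <= r + 3/5] ([vertical_slice]), and the other slices follow
    from the four equalities.

    The ends of a slice are boundary points of [K] by inspection. A point
    strictly inside one of the slices on [x = r], [y = r/2] and [x - y = r/2]
    lies in no translate [K + g] with [g <> 0]: the octagon excludes translates
    across the line, and the slice is exactly as long as the Gaussian period
    ([i], [1] and [1 + i]) of the line. This passes to [x + y = -r] by a step.
    By local finiteness of the
    tiling, a point of only one tile is interior to it ([interior_of_alone]). *)

(** * Series of digits in a contracted base *)

Lemma minus_plus_cancel (G : AbelianGroup) (x y : G) : plus (minus x y) y = x.
Proof. unfold minus; now rewrite <- plus_assoc, plus_opp_l, plus_zero_r. Qed.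

Section DigitSeries.

Context {K : AbsRing} {V : NormedModule K}.

(** The expansion with digits [e] and base [1 / c]. *)
Definition digit_term (c : K) (e : nat -> V) (k : nat) : V :=
  scal (pow_n c (S k)) (e k).

Lemma digit_term_S (c : K) (e : nat -> V) (k : nat) :
  digit_term c e (S k) = scal c (digit_term c (fun j => e (S j)) k).
Proof. unfold digit_term; rewrite scal_assoc; reflexivity. Qed.

Lemma digit_term_0 (c : K) (e : nat -> V) : digit_term c e 0 = scal c (e 0%nat).
Proof. unfold digit_term; simpl; now rewrite mult_one_r. Qed.

Lemma digit_series_tail (c c' : K) (e : nat -> V) (z : V) :
  mult c' c = one -> is_series (digit_term c e) z ->
  is_series (digit_term c (fun k => e (S k))) (minus (scal c' z) (e 0%nat)).
Proof.
  intros Hc Hz.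
  assert (H : is_series (fun k => digit_term c e (S k))
                (minus z (digit_term c e 0))).
  { apply (is_series_incr_1 (digit_term c e)).
    refine (eq_ind z (is_series (digit_term c e)) Hz _ _).
    symmetry; apply (minus_plus_cancel (NormedModule.AbelianGroup K V)). }
  apply (is_series_scal c') in H.
  assert (E : forall x : V, scal c' (scal c x) = x).
  { intros x; now rewrite scal_assoc, Hc, scal_one. }
  rewrite digit_term_0 in H.
  rewrite (scal_minus_distr_l (V := NormedModule.ModuleSpace K V)), E in H.
  revert H; apply is_series_ext; intros k.
  now rewrite digit_term_S, E.
Qed.

(** Peeling off the first digit, and not the last, makes the partial sums obey the
    hypothesis on [B]. *)
Lemma digit_sum_in (c : K) (E B : V -> Prop) :
  B zero -> (forall d x, E d -> B x -> B (scal c (plus d x))) ->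
  forall n e, (forall k, E (e k)) -> B (sum_n (digit_term c e) n).
Proof.
  intros B0 HB n; induction n as [|n IH]; intros e He.
  - rewrite sum_O, digit_term_0, <- (plus_zero_r (e 0%nat)); auto.
  - replace (sum_n (digit_term c e) (S n))
      with (scal c (plus (e 0%nat) (sum_n (digit_term c (fun j => e (S j))) n))).
    { apply HB; [apply He|apply IH; intros k; apply He]. }
    unfold sum_n at 2; rewrite sum_Sn_m, <- sum_n_m_S by lia.
    rewrite (scal_distr_l (V := NormedModule.ModuleSpace K V)), <- digit_term_0; f_equal.
    rewrite <- (sum_n_scal_l (V := NormedModule.ModuleSpace K V)); apply sum_n_ext; intros k.
    now rewrite digit_term_S.
Qed.

Lemma digit_series_in (c : K) (E B : V -> Prop) :
  closed B -> B zero -> (forall d x, E d -> B x -> B (scal c (plus d x))) ->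
  forall e z, (forall k, E (e k)) -> is_series (digit_term c e) z -> B z.
Proof.
  intros HB B0 Hstep e z He Hz.
  apply (closed_filterlim (sum_n (digit_term c e)) B z Hz); [|exact HB].
  intros n; now apply digit_sum_in with E.
Qed.

End DigitSeries.

(** * The twin dragon as a greatest fixed point *)

Local Notation K := twin_dragon.

Definition step (b : bool) (z : C) : C := (alpha * z - RtoC (digit b))%C.

Lemma step_coord (b : bool) (z : C) :
  step b z = (- fst z - snd z - digit b, fst z - snd z).
Proof. destruct z as [x y]; unfold step, alpha; apply injective_projections; simpl; ring. Qed.

Lemma digit_bool (b : bool) : digit b = 0 \/ digit b = 1.
Proof. destruct b; [right|left]; reflexivity. Qed.

Lemma digit_true : digit true = 1.
Proof. reflexivity. Qed.

Lemma digit_false : digit false = 0.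
Proof. reflexivity. Qed.

Lemma alpha_neq_0 : alpha <> 0%C.
Proof. unfold alpha; intros H; apply (f_equal snd) in H; simpl in H; lra. Qed.

Lemma pow_n_Cpow (c : C) (n : nat) : pow_n (K := C_Ring) c n = (c ^ n)%C.
Proof. induction n as [|n IH]; [reflexivity|]; simpl; now rewrite IH, ?Cpow_S. Qed.

Lemma twin_dragon_digit_series (z : C) :
  K z <-> exists d : nat -> bool,
    is_series (digit_term (V := C_NormedModule) (/ alpha)%C
      (fun k => RtoC (digit (d k)))) z.
Proof.
  assert (E : forall (d : nat -> bool) k,
    digit_term (V := C_NormedModule) (/ alpha)%C (fun k => RtoC (digit (d k))) k
    = (RtoC (digit (d k)) / alpha ^ S k)%C).
  { intros d k; unfold digit_term, Cdiv.
    change ((pow_n (K := C_Ring) (/ alpha) (S k) * RtoC (digit (d k)))%C = 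
      (RtoC (digit (d k)) * / alpha ^ S k)%C).
    rewrite pow_n_Cpow, Cpow_inv by apply alpha_neq_0; ring. }
  split; intros [d Hd]; exists d; revert Hd; apply is_series_ext; intros k;
    now rewrite E.
Qed.

(** A rational bound large enough to keep the disc of radius 3 stable under inverse
    steps, as needed in [twin_dragon_coind]. *)
Lemma Cmod_alpha : 7 / 5 <= Cmod alpha.
Proof.
  unfold Cmod, alpha; simpl.
  rewrite <- (sqrt_pow2 (7/5)) by lra; apply sqrt_le_1; lra.
Qed.

Lemma alpha_times_inv : (alpha * / alpha = 1)%C.
Proof. apply Cinv_r, alpha_neq_0. Qed.

Lemma twin_dragon_step (z : C) : K z -> exists b, K (step b z).
Proof.
  intros [d Hd]%twin_dragon_digit_series.
  exists (d 0%nat); apply twin_dragon_digit_series; exists (fun k => d (S k)).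
  apply (digit_series_tail (K := C_AbsRing) _ alpha) in Hd;
    [exact Hd|exact alpha_times_inv].
Qed.

(** After [n] digits the error of the expansion is [orb n / alpha ^ n], which tends
    to 0 when the orbit is bounded. *)
Lemma expansion_by_steps (d : nat -> bool) (orb : nat -> C) (M : R) :
  (forall n, orb (S n) = step (d n) (orb n)) -> (forall n, Cmod (orb n) <= M) ->
  K (orb 0%nat).
Proof.
  intros Hstep HM.
  exists d.
  set (a := fun k => (RtoC (digit (d k)) / alpha ^ S k)%C).
  assert (Hsum : forall n,
    minus (sum_n (G := C_AbelianMonoid) a n) (orb 0%nat) = (- (orb (S n) / alpha ^ S n))%C).
  { intros n; change ((sum_n (G := C_AbelianMonoid) a n - orb 0%nat)%C =
      (- (orb (S n) / alpha ^ S n))%C).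
    induction n as [|n IH].
    - rewrite sum_O, Hstep; unfold a, step; rewrite Cpow_1_r.
      field; apply alpha_neq_0.
    - rewrite sum_Sn.
      replace (plus _ (a (S n)) - orb 0%nat)%C
        with (sum_n (G := C_AbelianMonoid) a n - orb 0%nat + a (S n))%C
        by (change (@plus C_AbelianMonoid) with Cplus; ring).
      rewrite IH, (Hstep (S n)); unfold a, step; rewrite (Cpow_S _ (S n)).
      field; split; [apply Cpow_nz|]; apply alpha_neq_0. }
  apply filterlim_locally; intros eps.
  assert (Hq : Rabs (/ Cmod alpha) < 1).
  { pose proof Cmod_alpha.
    rewrite Rabs_pos_eq by (left; apply Rinv_0_lt_compat; lra).
    rewrite <- Rinv_1; apply Rinv_lt_contravar; lra. }
  assert (HM0 : 0 <= M) by (eapply Rle_trans; [apply Cmod_ge_0|apply (HM 0%nat)]).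
  assert (He : 0 < eps / (M + 1)) by (apply Rdiv_lt_0_compat; [apply cond_pos|lra]).
  destruct (proj2 (is_lim_seq_spec _ _) (is_lim_seq_geom _ Hq) (mkposreal _ He))
    as [N HN].
  exists N; intros n Hn.
  apply (norm_compat1 (V := C_NormedModule)).
  rewrite Hsum.
  change (Cmod (- (orb (S n) / alpha ^ S n))%C < eps).
  rewrite Cmod_opp, Cmod_div by (apply Cpow_nz, alpha_neq_0).
  rewrite Cmod_pow.
  specialize (HN (S n) ltac:(lia)); simpl pos in HN.
  rewrite Rminus_0_r, Rabs_pos_eq, pow_inv in HN
    by (apply pow_le; left; apply Rinv_0_lt_compat; pose proof Cmod_alpha; lra).
  apply Rle_lt_trans with ((M + 1) * / Cmod alpha ^ S n).
  - apply Rmult_le_compat_r; [|specialize (HM (S n)); lra].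
    left; apply Rinv_0_lt_compat, pow_lt; pose proof Cmod_alpha; lra.
  - apply Rmult_lt_compat_l with (r := M + 1) in HN; [|lra].
    replace ((M + 1) * (eps / (M + 1))) with (eps : R) in HN by (field; lra).
    exact HN.
Qed.

Definition steps (w : list bool) (z : C) : C := fold_left (fun x b => step b x) w z.

Lemma twin_dragon_coind1 (Q : C -> Prop) (M : R) :
  (forall z, Q z -> Cmod z <= M) -> (forall z, Q z -> exists b, Q (step b z)) ->
  forall z, Q z -> K z.
Proof.
  intros HM HQ z Hz.
  set (choice := fun x =>
    if excluded_middle_informative (Q (step true x)) then true else false).
  assert (Hchoice : forall x, Q x -> Q (step (choice x) x)).
  { intros x Hx; unfold choice.
    destruct (excluded_middle_informative (Q (step true x))) as [H|H]; [exact H|].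
    destruct (HQ x Hx) as [[|] Hb]; tauto. }
  set (orb := fun n => Nat.iter n (fun x => step (choice x) x) z).
  assert (Horb : forall n, Q (orb n)) by (induction n; simpl; auto).
  apply (expansion_by_steps (fun n => choice (orb n)) orb M); auto.
Qed.

(** The form with several steps at a time is the one for slices, which return to
    themselves only after four steps. *)
Lemma twin_dragon_coind (Q : C -> Prop) (M : R) :
  (forall z, Q z -> Cmod z <= M) ->
  (forall z, Q z -> exists b w, Q (steps w (step b z))) ->
  forall z, Q z -> K z.
Proof.
  intros HM HQ z Hz.
  apply (twin_dragon_coind1 (fun x => exists w, Q (steps w x)) (Rmax M 3)).
  - intros x [w Hw]; revert x Hw; induction w as [|b w IH]; intros x Hw.
    + eapply Rle_trans; [apply HM, Hw|apply Rmax_l].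
    + (* [|x| <= (R + 1) / |alpha| <= R] for [R = Rmax M 3], because [R >= 5/2] *)
      specialize (IH _ Hw); pose proof (Rmax_r M 3) as H3; pose proof Cmod_alpha.
      assert (Hx : Cmod (alpha * x) <= Rmax M 3 + 1).
      { replace (alpha * x)%C with (step b x + RtoC (digit b))%C by (unfold step; ring).
        eapply Rle_trans; [apply Cmod_triangle|].
        rewrite Cmod_R; destruct (digit_bool b) as [-> | ->];
          rewrite ?Rabs_R0, ?Rabs_R1; lra. }
      rewrite Cmod_mult in Hx; pose proof (Cmod_ge_0 x); nra.
  - intros x [[|b w] Hw].
    + destruct (HQ x Hw) as (b & w & H); exists b, w; exact H.
    + exists b, w; exact Hw.
  - exists nil; exact Hz.
Qed.

Lemma continuous_affine (a b c : R) (z : C) :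
  continuous (fun w : C => a * fst w + b * snd w + c) z.
Proof.
  apply (continuous_plus (V := R_NormedModule)); [|apply continuous_const].
  apply (continuous_plus (V := R_NormedModule));
    apply (continuous_mult (K := R_AbsRing)); try apply continuous_const;
    [apply continuous_fst|apply continuous_snd].
Qed.

Lemma closed_affine_le (a b c d : R) :
  closed (T := C_UniformSpace) (fun z : C => a * fst z + b * snd z + c <= d).
Proof.
  apply (closed_comp (fun w : C => a * fst w + b * snd w + c) (fun t => t <= d)).
  - intros; apply continuous_affine.
  - apply closed_le.
Qed.

(** The intersection of the half-planes that support [K] in the directions [x], [y],
    [x - y], [x + y], with the exact support values. An inverse step permutes these
    four directions up to scale, which makes the octagon stable. Each inequality
    is written in the affine form of [closed_affine_le]. *)
Definition octagon (z : C) : Prop :=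
  (- 1 * fst z + 0 * snd z + - (13 / 15) <= 0 /\ 1 * fst z + 0 * snd z + - (7 / 15) <= 0) /\
  (0 * fst z + - 1 * snd z + - (14 / 15) <= 0 /\ 0 * fst z + 1 * snd z + - (11 / 15) <= 0) /\
  (1 * fst z + - 1 * snd z + - (11 / 15) <= 0 /\ - 1 * fst z + 1 * snd z + - (14 / 15) <= 0) /\
  (- 1 * fst z + - 1 * snd z + - (22 / 15) <= 0 /\ 1 * fst z + 1 * snd z + - (13 / 15) <= 0).

Lemma octagon_closed : closed (T := C_UniformSpace) octagon.
Proof. repeat apply @closed_and; apply closed_affine_le. Qed.

Lemma twin_dragon_octagon (z : C) : K z -> octagon z.
Proof.
  intros [d Hd]%twin_dragon_digit_series.
  refine (digit_series_in (K := C_AbsRing) (V := C_NormedModule) _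
    (fun e => exists b, e = RtoC (digit b)) octagon _ _ _ _ z _ Hd).
  - exact octagon_closed.
  - unfold octagon; simpl; lra.
  - intros e x [b ->] Hx.
    change (octagon (/ alpha * (RtoC (digit b) + x))%C).
    replace (/ alpha * (RtoC (digit b) + x))%C with
      ((snd x - fst x - digit b) / 2, (- fst x - snd x - digit b) / 2)
      by (apply injective_projections; unfold alpha; simpl; field).
    unfold octagon in *; simpl; destruct (digit_bool b) as [-> | ->]; lra.
  - intros k; now exists (d k).
Qed.

Lemma twin_dragon_bounds (x y : R) : K (x, y) ->
  - (13 / 15) <= x <= 7 / 15 /\ - (14 / 15) <= y <= 11 / 15 /\
  - (11 / 15) <= y - x <= 14 / 15 /\ - (22 / 15) <= x + y <= 13 / 15.
Proof. intros H%twin_dragon_octagon; unfold octagon in H; simpl in H; lra. Qed.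

Lemma Cmod_le_sum (x y : R) : Cmod (x, y) <= Rabs x + Rabs y.
Proof.
  replace ((x, y) : C) with (RtoC x + RtoC y * Ci)%C
    by (apply injective_projections; simpl; ring).
  eapply Rle_trans; [apply Cmod_triangle|].
  rewrite Cmod_mult, !Cmod_R.
  replace (Cmod Ci) with 1; [lra|].
  unfold Cmod; simpl fst; simpl snd.
  replace (0 ^ 2 + 1 ^ 2) with 1 by ring; now rewrite sqrt_1.
Qed.

Lemma octagon_Cmod (z : C) : octagon z -> Cmod z <= 2.
Proof.
  destruct z as [x y]; unfold octagon; simpl; intros Ho.
  eapply Rle_trans; [apply Cmod_le_sum|]; split_Rabs; lra.
Qed.

Lemma twin_dragon_unfold (x y : R) :
  K (x, y) <-> exists b, K (- x - y - digit b, x - y).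
Proof.
  split.
  - intros [b Hb]%twin_dragon_step; exists b; now rewrite step_coord in Hb.
  - intros [b Hb].
    apply (twin_dragon_coind (fun z => z = (x, y) \/ K z) (Rmax (Cmod (x, y)) 2)).
    + intros z [-> | Hz]; [apply Rmax_l|].
      eapply Rle_trans; [apply octagon_Cmod, twin_dragon_octagon, Hz|apply Rmax_r].
    + intros z [-> | Hz].
      * exists b, nil; right; simpl; now rewrite step_coord.
      * destruct (twin_dragon_step z Hz) as [c Hc]; exists c, nil; now right.
    + now left.
Qed.

Lemma twin_dragon_unfold2 (x y : R) :
  K (x, y) <-> exists b c, K (2 * y + digit b - digit c, - 2 * x - digit b).
Proof.
  rewrite twin_dragon_unfold.
  assert (E : forall b c, ((2 * y + digit b - digit c, - 2 * x - digit b) : C) =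
    (- (- x - y - digit b) - (x - y) - digit c, - x - y - digit b - (x - y)))
    by (intros b c; apply injective_projections; simpl; ring).
  split.
  - intros (b & [c H]%twin_dragon_unfold); exists b, c; now rewrite E.
  - intros (b & c & H); exists b; apply twin_dragon_unfold; exists c; now rewrite <- E.
Qed.

Lemma twin_dragon_0 : K (0, 0).
Proof.
  apply (twin_dragon_coind (fun z => z = (0, 0)) 0); [| |reflexivity].
  - intros z ->; apply Req_le, Cmod_0.
  - intros z ->; exists false, nil; simpl; rewrite step_coord.
    apply injective_projections; simpl; unfold digit; simpl; ring.
Qed.

(** * The Gaussian translates of the twin dragon tile the plane *)

Lemma continuous_step (b : bool) (z : C) : continuous (step b) z.
Proof.
  apply (continuous_plus (V := C_NormedModule) (fun w => alpha * w)%C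
    (fun _ => - RtoC (digit b))%C); [|apply continuous_const].
  apply (continuous_scal_r (V := C_NormedModule) alpha (fun w : C => w)).
  apply continuous_id.
Qed.

Lemma continuous_translate (c z : C) : continuous (fun w : C => w - c)%C z.
Proof.
  apply (continuous_plus (V := C_NormedModule) (fun w : C => w) (fun _ => - c)%C);
    [apply continuous_id|apply continuous_const].
Qed.

(** The closure of [K] is bounded and again has a step at each of its points, so
    it lies in [K]. *)
Lemma twin_dragon_closed : closed (T := C_UniformSpace) K.
Proof.
  intros z Hz.
  apply (twin_dragon_coind (fun z => ~ locally z (fun w => ~ K w)) 2); [| |exact Hz].
  - intros x Hx; apply octagon_Cmod, octagon_closed.
    intros H; apply Hx; revert H; apply filter_imp.
    intros w Hw Kw; now apply Hw, twin_dragon_octagon.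
  - intros x Hx; apply NNPP; intros Hno; apply Hx.
    assert (Hstep : forall b, locally x (fun w => ~ K (step b w))).
    { intros b; apply (continuous_step b x (fun w => ~ K w)).
      apply NNPP; intros H; apply Hno; exists b, nil; exact H. }
    generalize (filter_and _ _ (Hstep true) (Hstep false)); apply filter_imp.
    intros w [Ht Hf] [[|] Hw]%twin_dragon_step; tauto.
Qed.

Definition gauss (m n : Z) : C := (IZR m, IZR n).

Lemma filter_forall_Z (T : Type) (F : (T -> Prop) -> Prop) (FF : Filter F)
  (P : Z -> T -> Prop) (N : nat) :
  (forall m, F (P m)) -> F (fun x => forall m, (Z.abs m <= Z.of_nat N)%Z -> P m x).
Proof.
  intros HP; induction N as [|N IH].
  - generalize (HP 0%Z); apply filter_imp; intros x Hx m Hm.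
    now replace m with 0%Z by lia.
  - generalize (filter_and _ _ IH
      (filter_and _ _ (HP (Z.of_nat (S N))) (HP (- Z.of_nat (S N))%Z))).
    apply filter_imp; intros x (H1 & H2 & H3) m Hm.
    destruct (Z.eq_dec m (Z.of_nat (S N))) as [-> | N1]; [exact H2|].
    destruct (Z.eq_dec m (- Z.of_nat (S N))) as [-> | N2]; [exact H3|].
    apply H1; lia.
Qed.

(** Closedness of each translate and local finiteness in one: near [z], only the
    translates that contain [z] are met. *)
Lemma translates_locally_finite (z : C) :
  locally z (fun w => forall m n, K (w - gauss m n)%C -> K (z - gauss m n)%C).
Proof.
  destruct (nfloor_ex (Rabs (fst z) + 3)) as [M [_ HM]];
    [pose proof (Rabs_pos (fst z)); lra|].
  destruct (nfloor_ex (Rabs (snd z) + 3)) as [N [_ HN]];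
    [pose proof (Rabs_pos (snd z)); lra|].
  assert (Hone : forall m n, locally z
    (fun w => K (w - gauss m n)%C -> K (z - gauss m n)%C)).
  { intros m n; destruct (classic (K (z - gauss m n)%C)) as [H|H];
      [now apply filter_forall|].
    assert (HO : locally (z - gauss m n)%C (fun w => ~ K w)).
    { apply NNPP; intros H'; apply H, twin_dragon_closed, H'. }
    generalize (continuous_translate (gauss m n) z (fun w => ~ K w) HO).
    unfold filtermap; apply filter_imp; tauto. }
  generalize (filter_and _ _ (locally_ball z (mkposreal 1 Rlt_0_1))
    (filter_forall_Z C (locally z) _ _ (S M)
      (fun m => filter_forall_Z C (locally z) _ _ (S N) (fun n => Hone m n)))).
  apply filter_imp; intros w [[Hx Hy] Hw] m n HK.
  assert (Hbox : Rabs (IZR m) <= INR (S M) /\ Rabs (IZR n) <= INR (S N)).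
  { destruct z as [x y], w as [u v]; unfold gauss in HK.
    replace ((u, v) - (IZR m, IZR n))%C with ((u - IZR m, v - IZR n) : C) in HK
      by (apply injective_projections; simpl; ring).
    apply twin_dragon_bounds in HK.
    change (Rabs (u - x) < 1) in Hx; change (Rabs (v - y) < 1) in Hy.
    apply Rabs_def2 in Hx; apply Rabs_def2 in Hy.
    rewrite !S_INR; simpl in HM, HN.
    split; apply Rabs_le; split_Rabs; lra. }
  destruct Hbox as [Hm Hn].
  rewrite <- abs_IZR, INR_IZR_INZ in Hm, Hn.
  apply le_IZR in Hm, Hn.
  now apply Hw.
Qed.

Definition tiled (z : C) : Prop := exists m n, K (z - gauss m n)%C.

Lemma tiled_closed : closed (T := C_UniformSpace) tiled.
Proof.
  intros z Hz; apply NNPP; intros Hno; apply Hz.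
  generalize (translates_locally_finite z); apply filter_imp.
  intros w Hw (m & n & HK); apply Hno; exists m, n; auto.
Qed.

(** A Gaussian integer [m + n i] is [alpha] times another one plus the parity bit
    of [m + n], so the union of the translates is stable under division by [alpha]. *)
Lemma tiled_of_alpha_mul (z : C) : tiled (alpha * z)%C -> tiled z.
Proof.
  intros (m & n & HK).
  assert (Hq : exists (q : Z) (b : bool), (m + n = - 2 * q + Z.b2z b)%Z).
  { exists (- Z.div2 (m + n))%Z, (Z.odd (m + n)).
    pose proof (Z.div2_odd (m + n)); lia. }
  destruct Hq as (q & b & Hq); exists (n + q)%Z, q.
  apply (f_equal IZR) in Hq; rewrite !plus_IZR, mult_IZR in Hq.
  replace (IZR (Z.b2z b)) with (digit b) in Hq by now destruct b.
  destruct z as [x y].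
  (* [alpha (p + q i) = (- p - q) + (p - q) i], so [q] as above and [p = n + q] *)
  replace ((x, y) - gauss (n + q) q)%C with ((x - IZR n - IZR q, y - IZR q) : C)
    by (apply injective_projections; unfold gauss; simpl; rewrite ?plus_IZR; ring).
  apply twin_dragon_unfold; exists b.
  replace (alpha * (x, y) - gauss m n)%C
    with ((- x - y - IZR m, x - y - IZR n) : C) in HK
    by (apply injective_projections; unfold gauss, alpha; simpl; ring).
  replace (- (x - IZR n - IZR q) - (y - IZR q) - digit b)
    with (- x - y - IZR m) by lra.
  now replace (x - IZR n - IZR q - (y - IZR q)) with (x - y - IZR n) by ring.
Qed.

(** The union of the translates contains the Gaussian integers, hence all their
    quotients by powers of [alpha], which are dense; and it is closed. *)
Lemma twin_dragon_tiles (z : C) : tiled z.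
Proof.
  assert (Hdense : forall n (w : C), exists v, tiled v /\ Cmod (w - v)%C <= 2 * (5 / 7) ^ n).
  { induction n as [|n IH]; intros w.
    - exists (gauss (up (fst w)) (up (snd w))); split.
      + exists (up (fst w)), (up (snd w)).
        replace (_ - _)%C with (0, 0)
          by (apply injective_projections; simpl; ring).
        apply twin_dragon_0.
      + replace (w - gauss (up (fst w)) (up (snd w)))%C
          with ((fst w - IZR (up (fst w)), snd w - IZR (up (snd w))) : C)
          by (apply injective_projections; simpl; ring).
        eapply Rle_trans; [apply Cmod_le_sum|].
        pose proof (archimed (fst w)); pose proof (archimed (snd w)).
        simpl; split_Rabs; lra.
    - destruct (IH (alpha * w)%C) as (v & Hv & Hd); exists (v / alpha)%C; split.
      + apply tiled_of_alpha_mul.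
        now replace (alpha * (v / alpha))%C with v by (field; apply alpha_neq_0).
      + replace (alpha * w - v)%C with (alpha * (w - v / alpha))%C in Hd
          by (field; apply alpha_neq_0).
        rewrite Cmod_mult in Hd; pose proof Cmod_alpha.
        pose proof (Cmod_ge_0 (w - v / alpha)%C); simpl; nra. }
  apply tiled_closed; intros [eps Heps].
  assert (Hq : Rabs (5 / 7) < 1) by (rewrite Rabs_pos_eq; lra).
  assert (He : 0 < eps / 2) by (pose proof (cond_pos eps); lra).
  destruct (proj2 (is_lim_seq_spec _ _) (is_lim_seq_geom _ Hq) (mkposreal _ He))
    as [N HN].
  specialize (HN N (Nat.le_refl N)); simpl pos in HN.
  rewrite Rminus_0_r, Rabs_pos_eq in HN by (apply pow_le; lra).
  destruct (Hdense N z) as (v & Hv & Hd).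
  apply (Heps v); [|exact Hv].
  apply (norm_compat1 (V := C_NormedModule)).
  change (Cmod (v - z)%C < eps).
  rewrite <- Cmod_opp; replace (- (v - z))%C with (z - v)%C by ring; lra.
Qed.

Definition in_no_other_translate (z : C) : Prop :=
  forall m n, K (z - gauss m n)%C -> m = 0%Z /\ n = 0%Z.

Lemma interior_of_alone (z : C) : in_no_other_translate z -> locally z K.
Proof.
  intros Hz.
  generalize (translates_locally_finite z); apply filter_imp; intros w Hw.
  destruct (twin_dragon_tiles w) as (m & n & HK).
  destruct (Hz m n (Hw m n HK)) as [-> ->].
  now replace (w - gauss 0 0)%C with w in HK
    by (apply injective_projections; simpl; ring).
Qed.

(** * Relations between the slices *)

Lemma Intersection_iff (A B : Ensemble C) (z : C) : (A ∩ B) z <-> A z /\ B z.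
Proof. split; [now intros [w HA HB]|now intros [HA HB]; split]. Qed.

Lemma Couple_digit (u v z : C) :
  {{ u, v }} z <-> exists b : bool, z = (if b then v else u).
Proof.
  split; [intros [|]; [now exists false|now exists true]|].
  intros [[|] ->]; constructor.
Qed.

(** The lines [x = r - 1] and [x = r + 1] miss the octagon. *)
Lemma same_vertical_digits (r y : R) (b c : bool) : - (8 / 15) < r < 2 / 15 ->
  K (r + digit b - digit c, y) -> b = c.
Proof.
  intros Hr HK%twin_dragon_bounds.
  destruct b, c; rewrite ?digit_true, ?digit_false in HK; (reflexivity || lra).
Qed.

Lemma horizontal_as_vertical (r x : R) : - (8 / 15) < r < 2 / 15 ->
  (K (x, r / 2) <-> exists b, K (r, - 2 * x - digit b)).
Proof.
  intros Hr; rewrite twin_dragon_unfold2; replace (2 * (r / 2)) with r by field.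
  split.
  - intros (b & c & HK).
    pose proof (same_vertical_digits _ _ _ _ Hr HK) as E; subst c.
    exists b; now replace (r + digit b - digit b) with r in HK by ring.
  - intros (b & HK); exists b, b; now replace (r + digit b - digit b) with r by ring.
Qed.

Lemma antidiagonal_as_vertical (r x y : R) : - (8 / 15) < r < 2 / 15 ->
  x + y = - r -> (K (x, y) <-> K (r, x - y)).
Proof.
  intros Hr Hxy; rewrite twin_dragon_unfold; split.
  - intros (b & HK); pose proof (twin_dragon_bounds _ _ HK) as HB.
    assert (E : digit b = 0) by (destruct (digit_bool b); lra).
    now replace (- x - y - digit b) with r in HK by lra.
  - intros HK; exists false; rewrite digit_false.
    now replace (- x - y - 0) with r by lra.
Qed.

Lemma diagonal_as_horizontal (r x y : R) : x - y = r / 2 ->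
  (K (x, y) <-> exists b, K (- x - y - digit b, r / 2)).
Proof. intros Hxy; now rewrite twin_dragon_unfold, Hxy. Qed.

Lemma dilate_horizontal_slice (r : R) : - (8 / 15) < r < 2 / 15 ->
  dilate (- 2 * Ci)%C (K ∩ line 0 1 (r / 2)) == sumset (K ∩ line 1 0 r) {{ 0, Ci }}.
Proof.
  intros Hr; split; intros z.
  - intros ([x y] & [HK HL]%Intersection_iff & ->); unfold line in HL; simpl in HL.
    assert (E : y = r / 2) by lra; subst y.
    apply (horizontal_as_vertical r x Hr) in HK; destruct HK as [b HK].
    exists (r, - 2 * x - digit b), (0, digit b); split; [|split].
    + apply Intersection_iff; split; [exact HK|unfold line; simpl; ring].
    + apply Couple_digit; exists b; destruct b; reflexivity.
    + apply injective_projections; simpl; field.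
  - intros ([s t] & w & [HK HL]%Intersection_iff & [b ->]%Couple_digit & ->).
    unfold line in HL; simpl in HL; assert (E : s = r) by lra; subst s.
    exists (- (t + digit b) / 2, r / 2); split.
    + apply Intersection_iff; split; [|unfold line; simpl; ring].
      apply (horizontal_as_vertical r _ Hr); exists b.
      now replace (- 2 * (- (t + digit b) / 2) - digit b) with t by field.
    + destruct b; rewrite ?digit_true, ?digit_false;
        apply injective_projections; simpl; field.
Qed.

Lemma dilate_antidiagonal_slice (r : R) : - (8 / 15) < r < 2 / 15 ->
  dilate (- 1 + Ci)%C (K ∩ line 1 1 (- r)) == K ∩ line 1 0 r.
Proof.
  intros Hr; split; intros z.
  - intros ([x y] & [HK HL]%Intersection_iff & ->); unfold line in HL; simpl in HL.
    assert (E : x + y = - r) by lra.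
    apply (antidiagonal_as_vertical r x y Hr E) in HK.
    replace ((- 1 + Ci) * (x, y))%C with ((r, x - y) : C)
      by (apply injective_projections; simpl; lra).
    apply Intersection_iff; split; [exact HK|unfold line; simpl; ring].
  - destruct z as [s t]; intros [HK HL]%Intersection_iff.
    unfold line in HL; simpl in HL; assert (E : s = r) by lra; subst s.
    exists ((t - r) / 2, - (r + t) / 2); split.
    + apply Intersection_iff; split; [|unfold line; simpl; field].
      apply (antidiagonal_as_vertical r _ _ Hr); [field|].
      now replace ((t - r) / 2 - - (r + t) / 2) with t by field.
    + apply injective_projections; simpl; field.
Qed.

Lemma dilate_diagonal_slice (r : R) :
  dilate (- 1 + Ci)%C (K ∩ line 1 (- 1) (r / 2))
    == sumset (K ∩ line 0 1 (r / 2)) {{ 0, 1 }}.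
Proof.
  split; intros z.
  - intros ([x y] & [HK HL]%Intersection_iff & ->); unfold line in HL; simpl in HL.
    assert (E : x - y = r / 2) by lra.
    apply (diagonal_as_horizontal r x y E) in HK; destruct HK as [b HK].
    exists (- x - y - digit b, r / 2), (digit b, 0); split; [|split].
    + apply Intersection_iff; split; [exact HK|unfold line; simpl; ring].
    + apply Couple_digit; exists b; destruct b; reflexivity.
    + apply injective_projections; simpl; lra.
  - intros ([s t] & w & [HK HL]%Intersection_iff & [b ->]%Couple_digit & ->).
    unfold line in HL; simpl in HL; assert (E : t = r / 2) by lra; subst t.
    exists ((r / 2 - s - digit b) / 2, (- (r / 2) - s - digit b) / 2); split.
    + apply Intersection_iff; split; [|unfold line; simpl; field].
      apply (diagonal_as_horizontal r); [field|]; exists b.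
      match goal with |- K (?p, _) => now replace p with s by field end.
    + destruct b; rewrite ?digit_true, ?digit_false;
        apply injective_projections; simpl; field.
Qed.

Lemma dilate_diagonal_slice_vertical (r : R) : - (8 / 15) < r < 2 / 15 ->
  dilate (2 * (1 + Ci))%C (K ∩ line 1 (- 1) (r / 2))
    == sumset (K ∩ line 1 0 r) (Union {{ - 2 * Ci, - Ci }} {{ 0, Ci }}).
Proof.
  intros Hr; split; intros z.
  - intros ([x y] & [HK HL]%Intersection_iff & ->); unfold line in HL; simpl in HL.
    assert (E : x - y = r / 2) by lra.
    apply (diagonal_as_horizontal r x y E) in HK; destruct HK as [b HK].
    apply (horizontal_as_vertical r _ Hr) in HK; destruct HK as [c HK].
    exists (r, - 2 * (- x - y - digit b) - digit c), (0, digit c - 2 * digit b).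
    split; [|split].
    + apply Intersection_iff; split; [exact HK|unfold line; simpl; ring].
    + destruct b; [left|right]; apply Couple_digit; exists c;
        destruct c; rewrite ?digit_true, ?digit_false;
        apply injective_projections; simpl; ring.
    + apply injective_projections; simpl; lra.
  - intros ([s t] & w & [HK HL]%Intersection_iff & Hw & ->).
    unfold line in HL; simpl in HL; assert (E : s = r) by lra; subst s.
    assert (Hbc : exists b c, w = (0, digit c - 2 * digit b)).
    { destruct Hw as [w Hw|w Hw]; apply Couple_digit in Hw; destruct Hw as [c ->];
        [exists true|exists false]; exists c; destruct c;
        rewrite ?digit_true, ?digit_false;
        apply injective_projections; simpl; ring. }
    destruct Hbc as (b & c & ->).
    set (h := t + digit c - 2 * digit b).
    exists ((h + r) / 4, (h - r) / 4); split.
    + apply Intersection_iff; split; [|unfold line; simpl; field].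
      apply (diagonal_as_horizontal r); [field|]; exists b.
      apply (horizontal_as_vertical r _ Hr); exists c.
      match goal with |- K (_, ?p) =>
        now replace p with t by (unfold h; field) end.
    + apply injective_projections; unfold h; simpl; field.
Qed.

(** * Reals with digits 0 and 2 in base -4 *)

Definition cantor_real (r : R) : Prop := exists a : nat -> bool,
  is_series (fun k => 2 * digit (a k) / (- 4) ^ S k) r /\ ~ ends_in_01 a.

Lemma cantor_digit_series (a : nat -> bool) (r : R) :
  is_series (fun k => 2 * digit (a k) / (- 4) ^ S k) r <->
  is_series (digit_term (V := R_NormedModule) (- / 4)
    (fun k => 2 * digit (a k))) r.
Proof.
  assert (E : forall k, digit_term (V := R_NormedModule) (- / 4)
      (fun k => 2 * digit (a k)) k = 2 * digit (a k) / (- 4) ^ S k).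
  { intros k; unfold digit_term.
    change (pow_n (K := R_Ring) (- / 4) (S k) * (2 * digit (a k)) =
      2 * digit (a k) / (- 4) ^ S k).
    rewrite pow_n_pow; replace (- / 4) with (/ -4) by field.
    rewrite pow_inv; unfold Rdiv; ring. }
  split; apply is_series_ext; intros k; now rewrite E.
Qed.

Lemma cantor_bounds (a : nat -> bool) (r : R) :
  is_series (fun k => 2 * digit (a k) / (- 4) ^ S k) r -> - (8 / 15) <= r <= 2 / 15.
Proof.
  intros Hr%cantor_digit_series.
  refine (digit_series_in (K := R_AbsRing) (V := R_NormedModule) _
    (fun e => exists b, e = 2 * digit b) (fun t => - (8 / 15) <= t <= 2 / 15)
    _ _ _ _ r _ Hr).
  - apply @closed_and; [apply closed_ge|apply closed_le].
  - change (- (8 / 15) <= 0 <= 2 / 15); lra.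
  - intros e t [b ->] Ht.
    change (- (8 / 15) <= - / 4 * (2 * digit b + t) <= 2 / 15).
    destruct (digit_bool b) as [-> | ->]; lra.
  - intros k; now exists (a k).
Qed.

Lemma cantor_tail (a : nat -> bool) (r : R) :
  is_series (fun k => 2 * digit (a k) / (- 4) ^ S k) r ->
  is_series (fun k => 2 * digit (a (S k)) / (- 4) ^ S k) (- 4 * r - 2 * digit (a 0%nat)).
Proof.
  intros Hr%cantor_digit_series.
  apply (cantor_digit_series (fun k => a (S k))).
  apply (digit_series_tail (K := R_AbsRing) _ (- 4)) in Hr; [exact Hr|].
  change (- 4 * - / 4 = 1); field.
Qed.

(** Each extreme value forces its first digit and has the other one as its tail, so
    that both expansions are purely periodic. *)
Lemma cantor_extremes (a : nat -> bool) :
  (is_series (fun k => 2 * digit (a k) / (- 4) ^ S k) (2 / 15) ->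
    a 0%nat = false /\
    is_series (fun k => 2 * digit (a (S k)) / (- 4) ^ S k) (- (8 / 15))) /\
  (is_series (fun k => 2 * digit (a k) / (- 4) ^ S k) (- (8 / 15)) ->
    a 0%nat = true /\
    is_series (fun k => 2 * digit (a (S k)) / (- 4) ^ S k) (2 / 15)).
Proof.
  split; intros H%cantor_tail; pose proof (cantor_bounds _ _ H) as HB;
    destruct (a 0%nat); unfold digit at 2 in H; unfold digit in HB; simpl in H, HB;
    try lra; split; try reflexivity.
  - replace (- (8 / 15)) with (- 4 * (2 / 15) - 2 * 0) by field; exact H.
  - replace (2 / 15) with (- 4 * - (8 / 15) - 2 * 1) by field; exact H.
Qed.

Lemma odd_of_extreme (k : nat) : forall a : nat -> bool,
  (is_series (fun k => 2 * digit (a k) / (- 4) ^ S k) (2 / 15) -> a k = Nat.odd k) /\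
  (is_series (fun k => 2 * digit (a k) / (- 4) ^ S k) (- (8 / 15)) ->
    a k = Nat.even k).
Proof.
  induction k as [|k IH]; intros a; destruct (cantor_extremes a) as [Hmax Hmin];
    split; intros H.
  - apply Hmax, H.
  - apply Hmin, H.
  - rewrite Nat.odd_succ; apply (proj2 (IH (fun j => a (S j)))), Hmax, H.
  - rewrite Nat.even_succ; apply (proj1 (IH (fun j => a (S j)))), Hmin, H.
Qed.

Lemma cantor_real_bounds (r : R) : cantor_real r -> - (8 / 15) < r < 2 / 15.
Proof.
  intros (a & Ha & Hend).
  destruct (cantor_bounds a r Ha) as [H1 H2].
  split; apply Rnot_le_lt; intros H; apply Hend.
  - replace r with (- (8 / 15)) in Ha by lra.
    exists 1%nat; intros k; change (a (1 + k)%nat) with ((fun j => a (S j)) k).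
    apply odd_of_extreme, cantor_extremes, Ha.
  - replace r with (2 / 15) in Ha by lra.
    exists 0%nat; intros k; now apply odd_of_extreme.
Qed.

(** Together with [cantor_real_bounds], this keeps every tail of [r] strictly inside
    the interval. *)
Lemma cantor_real_tail (r : R) :
  cantor_real r -> exists b, cantor_real (- 4 * r - 2 * digit b).
Proof.
  intros (a & Ha & Hend).
  exists (a 0%nat), (fun k => a (S k)); split; [now apply cantor_tail|].
  intros [n Hn]; apply Hend; now exists (S n).
Qed.

(** * The slices are segments *)

(** Only the digits with [d1 = a] and [d3 = d4] can occur, since the real part of
    the remainder differs by an integer from the tail of [r] and by less than 1
    from it by the octagon bounds. *)
Lemma vertical_slice_descent (r y : R) : cantor_real r -> K (r, y) ->
  exists r' y' b c, cantor_real r' /\ K (r', y') /\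
    y' - r' = - 4 * (y - r) + 2 * digit b - digit c.
Proof.
  intros Hr HK.
  destruct (cantor_real_tail r Hr) as [a Ha].
  apply twin_dragon_unfold2 in HK; destruct HK as (b1 & b2 & HK).
  apply twin_dragon_unfold2 in HK; destruct HK as (b3 & b4 & HK).
  exists (- 4 * r - 2 * digit a), (- 2 * (2 * y + digit b1 - digit b2) - digit b3), b2, b3.
  pose proof (twin_dragon_bounds _ _ HK) as HB.
  pose proof (cantor_real_bounds _ Ha) as Hr'.
  assert (H : digit b1 = digit a /\ digit b4 = digit b3).
  { destruct a, b1, b3, b4; rewrite ?digit_true, ?digit_false in *; lra. }
  destruct H as [H1 H4]; rewrite H1, H4 in *.
  split; [exact Ha|split; [|ring]].
  replace (- 4 * r - 2 * digit a)
    with (2 * (- 2 * r - digit a) + digit b3 - digit b3) by ring.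
  exact HK.
Qed.

(** Each descent divides the possible excess over the interval by 4. *)
Lemma vertical_slice_bounds (r y : R) :
  cantor_real r -> K (r, y) -> r - 2 / 5 <= y <= r + 3 / 5.
Proof.
  intros Hr HK.
  assert (H : forall n r y, cantor_real r -> K (r, y) ->
    - (2 / 5) - (1 / 4) ^ n <= y - r <= 3 / 5 + (1 / 4) ^ n).
  { clear r y Hr HK; induction n as [|n IH]; intros r y Hr HK.
    - apply twin_dragon_bounds in HK; simpl; lra.
    - destruct (vertical_slice_descent r y Hr HK) as (r' & y' & b & c & Hr' & HK' & E).
      specialize (IH r' y' Hr' HK'); simpl.
      destruct (digit_bool b) as [Hb | Hb], (digit_bool c) as [Hc | Hc];
        rewrite Hb, Hc in E; lra. }
  assert (Hlim : forall t, (forall n, t <= (1 / 4) ^ n) -> t <= 0).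
  { intros t Ht; apply Rnot_lt_le; intros Hpos.
    destruct (pow_lt_1_zero (1 / 4) ltac:(rewrite Rabs_pos_eq; lra) t Hpos) as [N HN].
    specialize (HN N (Nat.le_refl N)); specialize (Ht N).
    rewrite Rabs_pos_eq in HN by (apply pow_le; lra); lra. }
  split.
  - enough (r - 2 / 5 - y <= 0) by lra.
    apply Hlim; intros n; specialize (H n r y Hr HK); lra.
  - enough (y - r - 3 / 5 <= 0) by lra.
    apply Hlim; intros n; specialize (H n r y Hr HK); lra.
Qed.

Lemma vertical_slice (r y : R) :
  cantor_real r -> (K (r, y) <-> r - 2 / 5 <= y <= r + 3 / 5).
Proof.
  intros Hr; split; [now apply vertical_slice_bounds|intros Hy].
  apply (twin_dragon_coind (fun z => cantor_real (fst z) /\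
    - (2 / 5) <= snd z - fst z <= 3 / 5) 3); [| |simpl; split; [exact Hr|lra]].
  - intros [s t] [Hs%cantor_real_bounds Ht]; simpl in *.
    eapply Rle_trans; [apply Cmod_le_sum|]; split_Rabs; lra.
  - intros [s t] [Hs Ht]; simpl in *.
    destruct (cantor_real_tail s Hs) as [a Ha].
    (* [-4 (t - s)] is in [-12/5, 8/5], which the unit interval [-2/5, 3/5] covers
       when it is moved by the values -2, -1, 0, 1 of [c - 2 b] *)
    assert (Hbc : exists b c, - (2 / 5) <= - 4 * (t - s) + 2 * digit b - digit c <= 3 / 5).
    { destruct (Rle_lt_dec (- 4 * (t - s)) (- (7 / 5)));
        [exists true, false; rewrite digit_true, digit_false; lra|].
      destruct (Rle_lt_dec (- 4 * (t - s)) (- (2 / 5)));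
        [exists true, true; rewrite digit_true; lra|].
      destruct (Rle_lt_dec (- 4 * (t - s)) (3 / 5));
        [exists false, false; rewrite digit_false; lra|].
      exists false, true; rewrite digit_true, digit_false; lra. }
    destruct Hbc as (b & c & Hbc).
    exists a, (b :: c :: c :: nil)%list.
    unfold steps, fold_left; rewrite !step_coord; simpl; split; [|lra].
    match goal with |- cantor_real ?x =>
      now replace x with (- 4 * s - 2 * digit a) by ring end.
Qed.

Lemma IZR_small (m : Z) : - 1 < IZR m < 1 -> m = 0%Z.
Proof. intros [H1 H2]; apply lt_IZR in H1, H2; lia. Qed.

Lemma sub_gauss (x y : R) (m n : Z) :
  ((x, y) - gauss m n)%C = (x - IZR m, y - IZR n).
Proof. apply injective_projections; simpl; ring. Qed.

Lemma vertical_alone (r y : R) : cantor_real r ->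
  r - 2 / 5 < y < r + 3 / 5 -> in_no_other_translate (r, y).
Proof.
  intros Hr Hy m n; rewrite sub_gauss; intros HK.
  pose proof (twin_dragon_bounds _ _ HK) as HB.
  pose proof (cantor_real_bounds _ Hr).
  assert (m = 0%Z) by (apply IZR_small; lra); subst m.
  split; [reflexivity|].
  rewrite Rminus_0_r in HK; apply (vertical_slice _ _ Hr) in HK.
  apply IZR_small; lra.
Qed.

Lemma horizontal_slice (r x : R) : cantor_real r ->
  (K (x, r / 2) <-> - (4 / 5) - r / 2 <= x <= 1 / 5 - r / 2).
Proof.
  intros Hr; rewrite (horizontal_as_vertical r x (cantor_real_bounds _ Hr)).
  assert (Hs : forall b, K (r, - 2 * x - digit b) <->
    r - 2 / 5 <= - 2 * x - digit b <= r + 3 / 5)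
    by (intros b; now apply vertical_slice).
  split.
  - intros (b & HK%Hs); destruct (digit_bool b); lra.
  - intros Hx; destruct (Rle_lt_dec (- 2 * x) (r + 3 / 5));
      [exists false|exists true]; apply Hs; rewrite ?digit_true, ?digit_false; lra.
Qed.

Lemma horizontal_alone (r x : R) : cantor_real r ->
  - (4 / 5) - r / 2 < x < 1 / 5 - r / 2 -> in_no_other_translate (x, r / 2).
Proof.
  intros Hr Hx m n; rewrite sub_gauss; intros HK.
  pose proof (twin_dragon_bounds _ _ HK) as HB.
  pose proof (cantor_real_bounds _ Hr).
  assert (n = 0%Z) by (apply IZR_small; lra); subst n.
  split; [|reflexivity].
  rewrite Rminus_0_r in HK; apply (horizontal_slice _ _ Hr) in HK.
  apply IZR_small; lra.
Qed.

Lemma antidiagonal_slice (r x y : R) : cantor_real r -> x + y = - r ->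
  (K (x, y) <-> - (1 / 5) <= x <= 3 / 10).
Proof.
  intros Hr Hxy.
  rewrite (antidiagonal_as_vertical r x y (cantor_real_bounds _ Hr) Hxy).
  rewrite (vertical_slice r _ Hr); lra.
Qed.

(** The octagon is too large to exclude the translates across this line, those by
    [m + n i] with [m + n = 1]. But multiplication by [alpha] sends
    the point strictly inside the slice on [x = r], and [K + g] into translates
    by [alpha g] and [alpha g + 1], none of which is [K] when [g <> 0]. *)
Lemma antidiagonal_alone (r x y : R) : cantor_real r -> x + y = - r ->
  - (1 / 5) < x < 3 / 10 -> in_no_other_translate (x, y).
Proof.
  intros Hr Hxy Hx m n; rewrite sub_gauss; intros [b HK]%twin_dragon_unfold.
  assert (Ha : in_no_other_translate (r, x - y)) by (apply vertical_alone; [exact Hr|lra]).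
  assert (H : (- m - n + Z.b2z b)%Z = 0%Z /\ (m - n)%Z = 0%Z).
  { apply Ha; rewrite sub_gauss, plus_IZR, !minus_IZR, opp_IZR.
    replace (IZR (Z.b2z b)) with (digit b) by now destruct b.
    match goal with H : K (?p, ?q) |- K (?p', ?q') =>
      now replace p' with p by lra; replace q' with q by ring end. }
  destruct b; simpl in H; lia.
Qed.

Lemma diagonal_slice (r x y : R) : cantor_real r -> x - y = r / 2 ->
  (K (x, y) <-> - (3 / 5) <= y <= 2 / 5).
Proof.
  intros Hr Hxy; rewrite (diagonal_as_horizontal r x y Hxy); split.
  - intros (b & HK); apply (horizontal_slice _ _ Hr) in HK.
    destruct (digit_bool b); lra.
  - intros Hy; destruct (Rle_lt_dec (- 2 * y) (1 / 5)); [exists false|exists true];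
      rewrite ?digit_true, ?digit_false; apply horizontal_slice; (exact Hr || lra).
Qed.

Lemma diagonal_alone (r x y : R) : cantor_real r -> x - y = r / 2 ->
  - (3 / 5) < y < 2 / 5 -> in_no_other_translate (x, y).
Proof.
  intros Hr Hxy Hy m n; rewrite sub_gauss; intros HK.
  pose proof (twin_dragon_bounds _ _ HK) as HB.
  pose proof (cantor_real_bounds _ Hr).
  assert (Hmn : (m - n)%Z = 0%Z) by (apply IZR_small; rewrite minus_IZR; lra).
  assert (m = n) by lia; subst m.
  apply (diagonal_slice r) in HK; [|exact Hr|lra].
  assert (n = 0%Z) by (apply IZR_small; lra); subst n; auto.
Qed.

(** * Boundary of a slice *)

Lemma continuous_segment (u v : C) (t : R) :
  continuous (fun s : R => RtoC (1 - s) * u + RtoC s * v)%C t.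
Proof.
  apply (continuous_ext (fun s => plus (scal (V := C_R_NormedModule) (1 - s) u)
    (scal (V := C_R_NormedModule) s v))); [intros s; now rewrite !scal_R_Cmult|].
  apply (continuous_plus (V := C_R_NormedModule));
    apply (continuous_scal_l (V := C_R_NormedModule)); [|apply continuous_id].
  apply (continuous_minus (V := R_NormedModule) (fun _ => 1) (fun s => s));
    [apply continuous_const|apply continuous_id].
Qed.

(** The boundary in the line is contained in the boundary in the plane, which has
    no point strictly inside the slice by tiling, and the two ends are limits of
    points of the line beyond them. The coordinate [f] on the line stands for its
    parametrisation. *)
Lemma segment_slice (D : Ensemble C) (f : C -> R) (u v : C) :
  let pt := fun t : R => (RtoC (1 - t) * u + RtoC t * v)%C in
  (forall t, D (pt t) /\ f (pt t) = t) ->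
  (forall w, D w -> w = pt (f w)) ->
  (forall w, D w -> (K w <-> 0 <= f w <= 1)) ->
  (forall w, D w -> 0 < f w < 1 -> in_no_other_translate w) ->
  K ∩ D == closed_segment u v /\
  boundary K ∩ D == boundary_in D (K ∩ D) /\
  boundary_in D (K ∩ D) == {{ u, v }}.
Proof.
  intros pt Hpt HD HK Hint.
  assert (Hu : pt 0 = u) by (unfold pt; rewrite Rminus_0_r; ring).
  assert (Hv : pt 1 = v) by (unfold pt; rewrite Rminus_diag; ring).
  assert (H12 : forall z, boundary_in D (K ∩ D) z -> (boundary K ∩ D) z).
  { intros z [Dz Hz]; split; [|exact Dz].
    intros P HP; destruct (Hz P HP) as [(w & _ & Pw & Hw) (w' & Dw' & Pw' & Hw')].
    split; [exists w; split; [exact Pw|now destruct Hw]|].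
    exists w'; split; [exact Pw'|].
    intros Kw'; now apply Hw'; split. }
  assert (H23 : forall z, (boundary K ∩ D) z -> {{ u, v }} z).
  { intros z [z' Hz Dz].
    assert (Kz : K z').
    { apply twin_dragon_closed; intros H.
      destruct (Hz _ H) as [(w & Hw & Kw) _]; now apply Hw. }
    apply (HK _ Dz) in Kz.
    destruct (Req_dec (f z') 0) as [E | N0];
      [rewrite (HD _ Dz), E, Hu; constructor|].
    destruct (Req_dec (f z') 1) as [E | N1];
      [rewrite (HD _ Dz), E, Hv; constructor|].
    exfalso.
    destruct (Hz K) as [_ (w & Kw & Hw)]; [|now apply Hw].
    apply interior_of_alone, Hint; [exact Dz|lra]. }
  (* [s] is the direction in which the line leaves the segment at [pt t] *)
  assert (Hend : forall t s, 0 <= t <= 1 -> s = 1 \/ s = - 1 ->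
    (forall e, 0 < e -> ~ 0 <= t + s * e <= 1) -> boundary_in D (K ∩ D) (pt t)).
  { intros t s Ht Hs Hout; destruct (Hpt t) as [Dt Ft].
    split; [exact Dt|intros P HP; split].
    - exists (pt t); split; [exact Dt|split; [now apply locally_singleton|]].
      split; [apply HK; [exact Dt|lra]|exact Dt].
    - destruct (continuous_segment u v t P HP) as [e He].
      assert (Hin : P (pt (t + s * (e / 2)))).
      { apply He; change (Rabs (t + s * (e / 2) - t) < e).
        pose proof (cond_pos e); destruct Hs as [-> | ->]; split_Rabs; lra. }
      exists (pt (t + s * (e / 2))); destruct (Hpt (t + s * (e / 2))) as [Dt' Ft'].
      split; [exact Dt'|split; [exact Hin|]].
      intros [Kw _]%Intersection_iff; apply HK in Kw; [|exact Dt'].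
      rewrite Ft' in Kw; revert Kw; apply Hout.
      pose proof (cond_pos e); lra. }
  assert (H31 : forall z, {{ u, v }} z -> boundary_in D (K ∩ D) z).
  { intros z [|].
    - rewrite <- Hu; apply (Hend 0 (- 1)); [lra|now right|intros; lra].
    - rewrite <- Hv; apply (Hend 1 1); [lra|now left|intros; lra]. }
  split; [|split]; split; intros z Hz.
  - destruct Hz as [z Kz Dz]; exists (f z); split; [now apply HK|now apply HD].
  - destruct Hz as (t & Ht & ->); destruct (Hpt t) as [Dt Ft].
    split; [|exact Dt]; apply HK; [exact Dt|]; change (0 <= f (pt t) <= 1); now rewrite Ft.
  - apply H31, H23, Hz.
  - apply H12, Hz.
  - apply H23, H12, Hz.
  - apply H31, Hz.
Qed.

Theorem theorem3p2 :
  (forall r : R, - (8 / 15) < r < 2 / 15 ->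
     dilate (- 2 * Ci)%C (twin_dragon ∩ line 0 1 (r / 2))
       == sumset (twin_dragon ∩ line 1 0 r) {{ 0, Ci }}
     /\
     dilate (- 1 + Ci)%C (twin_dragon ∩ line 1 1 (- r))
       == twin_dragon ∩ line 1 0 r
     /\
     dilate (- 1 + Ci)%C (twin_dragon ∩ line 1 (- 1) (r / 2))
       == sumset (twin_dragon ∩ line 0 1 (r / 2)) {{ 0, 1 }}
     /\
     dilate (2 * (1 + Ci))%C (twin_dragon ∩ line 1 (- 1) (r / 2))
       == sumset (twin_dragon ∩ line 1 0 r)
            (Union {{ - 2 * Ci, - Ci }} {{ 0, Ci }}))
  /\
  (forall (r : R) (a : nat -> bool),
     is_series (fun k => 2 * digit (a k) / (- 4) ^ S k) r ->
     ~ ends_in_01 a ->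
     (let D := line 0 1 (r / 2) in
      let u : C := (- (4 / 5) - r / 2, r / 2) in
      let v : C := (1 / 5 - r / 2, r / 2) in
      twin_dragon ∩ D == closed_segment u v
      /\ boundary twin_dragon ∩ D == boundary_in D (twin_dragon ∩ D)
      /\ boundary_in D (twin_dragon ∩ D) == {{ u, v }})
     /\
     (let D := line 1 1 (- r) in
      let u : C := (- (1 / 5), 1 / 5 - r) in
      let v : C := (3 / 10, - (3 / 10 + r)) in
      twin_dragon ∩ D == closed_segment u v
      /\ boundary twin_dragon ∩ D == boundary_in D (twin_dragon ∩ D)
      /\ boundary_in D (twin_dragon ∩ D) == {{ u, v }})
     /\
     (let D := line 1 (- 1) (r / 2) in
      let u : C := (- (3 / 5) + r / 2, - (3 / 5)) in
      let v : C := (2 / 5 + r / 2, 2 / 5) in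
      twin_dragon ∩ D == closed_segment u v
      /\ boundary twin_dragon ∩ D == boundary_in D (twin_dragon ∩ D)
      /\ boundary_in D (twin_dragon ∩ D) == {{ u, v }})).
Proof.
  split.
  - intros r Hr; split; [|split; [|split]].
    + now apply dilate_horizontal_slice.
    + now apply dilate_antidiagonal_slice.
    + now apply dilate_diagonal_slice.
    + now apply dilate_diagonal_slice_vertical.
  - intros r a Ha Hend.
    assert (Hr : cantor_real r) by now exists a.
    split; [|split]; intros D u v.
    + apply (segment_slice D (fun w => fst w + 4 / 5 + r / 2)).
      * intros t; split; unfold D, u, v, line; simpl; field.
      * intros [x y] HL; unfold D, line in HL; simpl in HL.
        apply injective_projections; simpl; lra.
      * intros [x y] HL; unfold D, line in HL; simpl in HL; simpl.
        replace y with (r / 2) by lra; rewrite (horizontal_slice r x Hr); lra.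
      * intros [x y] HL; unfold D, line in HL; simpl in HL; simpl; intros Hx.
        replace y with (r / 2) by lra; apply horizontal_alone; [exact Hr|lra].
    + apply (segment_slice D (fun w => 2 * (fst w + 1 / 5))).
      * intros t; split; unfold D, u, v, line; simpl; field.
      * intros [x y] HL; unfold D, line in HL; simpl in HL.
        apply injective_projections; simpl; lra.
      * intros [x y] HL; unfold D, line in HL; simpl in HL; simpl.
        rewrite (antidiagonal_slice r x y Hr); lra.
      * intros [x y] HL; unfold D, line in HL; simpl in HL; simpl; intros Hx.
        apply (antidiagonal_alone r); [exact Hr|lra|lra].
    + apply (segment_slice D (fun w => snd w + 3 / 5)).
      * intros t; split; unfold D, u, v, line; simpl; field.
      * intros [x y] HL; unfold D, line in HL; simpl in HL.
        apply injective_projections; simpl; lra.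
      * intros [x y] HL; unfold D, line in HL; simpl in HL; simpl.
        rewrite (diagonal_slice r x y Hr); lra.
      * intros [x y] HL; unfold D, line in HL; simpl in HL; simpl; intros Hx.
        apply (diagonal_alone r); [exact Hr|lra|lra].
Qed.
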